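(* Let $\mathcal{X}$ be a non-empty finite set and let $N \geq 1$. A coherent lower prevision $\underline{P}^N$ on $\mathcal{L}(\mathcal{X}^N)$ is exchangeable if and only if there is some coherent lower prevision $\underline{Q}$ on $\mathcal{L}(\mathcal{N}^N)$ such that $$\underline{P}^N(f) = \underline{Q}\bigl(MuHy^N(f|\cdot)\bigr) \quad \text{for all } f \in \mathcal{L}(\mathcal{X}^N).$$ Moreover, if a coherent lower prevision $\underline{P}^N$ on $\mathcal{L}(\mathcal{X}^N)$ is exchangeable, then the corresponding $\underline{Q}$ is given by $$\underline{Q}(h) = \underline{P}^N(h \circ \mathbf{T}^N) \quad \text{for all } h \in \mathcal{L}(\mathcal{N}^N).$$
   Context: A gamble on a non-empty set $Y$ is a bounded map $f: Y \to \mathbb{R}$; $\mathcal{L}(Y)$ is the linear space of all gambles on $Y$. A lower prevision on a linear space of gambles $\mathcal{K} \subseteq \mathcal{L}(Y)$ is a real-valued functional $\underline{P}: \mathcal{K} \to \mathbb{R}$; it is coherent if for all $f, g \in \mathcal{K}$ and all real $\lambda \geq 0$: (P1) $\underline{P}(f) \geq \inf f$; (P2) $\underline{P}(\lambda f) = \lambda \underline{P}(f)$; (P3) $\underline{P}(f+g) \geq \underline{P}(f) + \underline{P}(g)$. Let $\mathcal{P}_N$ be the set of permutations of $\{1,\dots,N\}$. For $\pi \in \mathcal{P}_N$ and $\mathbf{x} = (x_1,\dots,x_N) \in \mathcal{X}^N$, put $\pi\mathbf{x} := (x_{\pi(1)},\dots,x_{\pi(N)})$, and for a gamble $f$ on $\mathcal{X}^N$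 let $\pi f$ be the gamble $(\pi f)(\mathbf{x}) := f(\pi\mathbf{x})$. A coherent lower prevision $\underline{P}^N$ on $\mathcal{L}(\mathcal{X}^N)$ is called exchangeable if $\underline{P}^N(\pi f - f) \geq 0$ for all $f \in \mathcal{L}(\mathcal{X}^N)$ and all $\pi \in \mathcal{P}_N$. The set of count vectors is $\mathcal{N}^N := \{\mathbf{m} \in \mathbb{N}_0^{\mathcal{X}} : \sum_{x \in \mathcal{X}} m_x = N\}$, where $\mathbb{N}_0$ is the set of non-negative integers. The counting map $\mathbf{T}^N: \mathcal{X}^N \to \mathcal{N}^N$ has components $T^N_x(\mathbf{z}) := |\{k \in \{1,\dots,N\} : z_k = x\}|$, $x \in \mathcal{X}$. For $\mathbf{m} \in \mathcal{N}^N$ let $[\mathbf{m}] := \{\mathbf{z} \in \mathcal{X}^N : \mathbf{T}^N(\mathbf{z}) = \mathbf{m}\}$, which has $\nu(\mathbf{m}) := N!/\prod_{x \in \mathcal{X}} m_x!$ elements. For $f \in \mathcal{L}(\mathcal{X}^N)$, $MuHy^N(f|\cdot)$ is the gamble on $\mathcal{N}^N$ defined by $$MuHy^N(f|\mathbf{m}) := \frac{1}{\nu(\mathbf{m})} \sum_{\mathbf{z} \in [\mathbf{m}]} f(\mathbf{z}).$$ *)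

(* Defs.v *)
From HB Require Import structures.
From mathcomp Require Import all_boot all_order all_algebra all_fingroup.
From mathcomp Require Import all_classical all_reals all_analysis.

Set Implicit Arguments.
Unset Strict Implicit.
Unset Printing Implicit Defensive.

Import Order.TTheory GRing.Theory Num.Theory.
Import numFieldNormedType.Exports.

Local Open Scope classical_set_scope.
Local Open Scope ring_scope.

Section Gamble.
Context {R : realType} {Y : Type}.

(* The codomain is [R^o] so that [Y -> R^o] is an [lmodType R]. *)
Definition bounded_pred : {pred Y -> R^o} := mem [set f | bounded_fun f].

Lemma bounded_predP (f : Y -> R^o) :
  f \in bounded_pred <-> exists M : R, forall y, `|f y| <= M.
Proof.
rewrite inE /=; split=> [[M [_ fM]]|[M fM]].
  by exists (M + 1) => y; apply: (fM (M + 1)); rewrite ?ltrDl.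
exists M; split; first exact: num_real.
by move=> M' /ltW MM' y _; exact: le_trans (fM y) MM'.
Qed.

Lemma bounded_pred_submod : submod_closed bounded_pred.
Proof.
split=> [|a f g /bounded_predP[M fM] /bounded_predP[M' gM']];
  apply/bounded_predP; first by exists 0 => y; rewrite normr0.
exists (`|a| * M + M') => y; rewrite (le_trans (ler_normD _ _))// lerD//.
by rewrite normrM ler_wpM2l.
Qed.

HB.instance Definition _ :=
  GRing.isSubmodClosed.Build R (Y -> R^o) bounded_pred bounded_pred_submod.

Record gamble := Gamble {
  gamble_fun :> Y -> R^o;
  gambleP : gamble_fun \in bounded_pred }.

HB.instance Definition _ := [isSub for gamble_fun].
HB.instance Definition _ := [Choice of gamble by <:].
HB.instance Definition _ := [SubChoice_isSubLmodule of gamble by <:].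

(* Lower previsions whose domain is the space of all gambles on [Y]; [inf] is
   the infimum of [reals], meaningful here because ranges of gambles are bounded
   and [Y] is non-empty in every use. *)
Definition coherent (P : gamble -> R) : Prop :=
  [/\ forall f : gamble, inf (range f) <= P f,
      forall (f : gamble) (a : R), 0 <= a -> P (a *: f) = a * P f
    & forall f g : gamble, P f + P g <= P (f + g)].

End Gamble.

Arguments gamble : clear implicits.

Lemma comp_bounded (R : realType) (Y Z : Type) (h : gamble R Z) (t : Y -> Z) :
  ((h : Z -> R^o) \o t) \in bounded_pred.
Proof.
have /bounded_predP[M hM] := gambleP h.
by apply/bounded_predP; exists M => y; exact: hM.
Qed.

Definition gamble_comp (R : realType) (Y Z : Type) (h : gamble R Z)
  (t : Y -> Z) : gamble R Y := Gamble (comp_bounded h t).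

Lemma fin_bounded (R : realType) (Y : finType) (f : Y -> R^o) :
  f \in bounded_pred.
Proof.
apply/bounded_predP; exists (\sum_y `|f y|) => y.
by rewrite (bigD1 y)//= lerDl sumr_ge0.
Qed.

(* [X^N] is [{ffun 'I_N -> X}], with positions numbered from 0 to N - 1. *)
Section Exchangeable.
Context {R : realType} {X : finType} {N : nat}.

Definition perm_act (p : {perm 'I_N}) (x : {ffun 'I_N -> X}) :
  {ffun 'I_N -> X} := [ffun k => x (p k)].

Definition perm_gamble (p : {perm 'I_N}) (f : gamble R {ffun 'I_N -> X}) :
  gamble R {ffun 'I_N -> X} := gamble_comp f (perm_act p).

Definition exchangeable (P : gamble R {ffun 'I_N -> X} -> R) : Prop :=
  forall (f : gamble R {ffun 'I_N -> X}) (p : {perm 'I_N}),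
    0 <= P (perm_gamble p f - f).

End Exchangeable.

Record count_vector (X : finType) (N : nat) := CountVector {
  count_fun :> {ffun X -> nat};
  count_vectorP : (\sum_x count_fun x == N)%N }.

HB.instance Definition _ (X : finType) (N : nat) :=
  [isSub for @count_fun X N].
HB.instance Definition _ (X : finType) (N : nat) :=
  [Countable of count_vector X N by <:].

(* The [finType] structure only serves to make every real function on count
   vectors a gamble. *)
Section CountVectorFinite.
Context {X : finType} {N : nat}.

Definition count_to_ord (m : count_vector X N) : {ffun X -> 'I_N.+1} :=
  [ffun x => inord (m x)].

Definition count_of_ord (u : {ffun X -> 'I_N.+1}) : option (count_vector X N) :=
  insub [ffun x => nat_of_ord (u x)].

Lemma count_to_ordK : pcancel count_to_ord count_of_ord.
Proof.
move=> m; rewrite /count_of_ord.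
suff -> : [ffun x => nat_of_ord (count_to_ord m x)] = val m by rewrite valK.
apply/ffunP => x; rewrite !ffunE inordK// ltnS.
have : (m x <= \sum_y m y)%N by rewrite (bigD1 x)//= leq_addr.
by rewrite (eqP (count_vectorP m)).
Qed.

HB.instance Definition _ : fintype.isFinite (count_vector X N) :=
  PCanIsFinite count_to_ordK.

End CountVectorFinite.

Section Counting.
Context {R : realType} {X : finType} {N : nat}.

Definition counts (z : {ffun 'I_N -> X}) : {ffun X -> nat} :=
  [ffun x => #|[set k | z k == x]%SET|].

Lemma counts_sum (z : {ffun 'I_N -> X}) : (\sum_x counts z x == N)%N.
Proof.
apply/eqP; rewrite -[RHS]card_ord -sum1_card.
rewrite (partition_big (fun k => z k) xpredT)//=.
by apply: eq_bigr => x _; rewrite ffunE -sum1dep_card; apply: eq_bigl.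
Qed.

Definition counting_map (z : {ffun 'I_N -> X}) : count_vector X N :=
  CountVector (counts_sum z).

Definition nu (m : count_vector X N) : R :=
  (N`!)%:R / \prod_x ((m x)`!)%:R.

Definition MuHy_fun (f : gamble R {ffun 'I_N -> X}) (m : count_vector X N) :
  R^o := (nu m)^-1 * \sum_(z | counting_map z == m) f z.

Definition MuHy (f : gamble R {ffun 'I_N -> X}) : gamble R (count_vector X N) :=
  Gamble (fin_bounded (MuHy_fun f)).

End Counting.

(* Main.v *)
(** Both averaging over all permutations and [f |-> MuHy f \o counting_map]
    replace [f] by its mean over each orbit, because the orbits of the
    permutation action are the fibres of the counting map; an exchangeable
    [P] cannot distinguish [f] from this mean, by superadditivity.  Conversely,
    [MuHy] annihilates [perm_gamble p f - f].  Since a fibre has [nu m]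
    elements, [MuHy (gamble_comp h counting_map) = h], which determines [Q]. *)
Require Import Defs.
From mathcomp Require Import all_boot all_order all_algebra all_fingroup.
From mathcomp Require Import all_classical all_reals all_analysis.

Import Order.TTheory GRing.Theory Num.Theory.

Local Open Scope ring_scope.

(** * Counting words with prescribed letter multiplicities *)

Section Multinomial.
Variable X : finType.

(** Sort the words by their first letter [y], which must satisfy [0 < m y]; this also makes the
    truncated subtraction exact. *)
Lemma card_tuple_count_cons (n : nat) (m : X -> nat) :
  #|[set t : n.+1.-tuple X | [forall x, count_mem x t == m x]]%SET| =
  (\sum_(y | 0 < m y) #|[set t : n.-tuple X |
     [forall x, count_mem x t == m x - (x == y)]]%SET|)%N.
Proof.
rewrite -sum1dep_card (partition_big (@thead n X) (fun y => 0 < m y)%N) /=.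
  apply: eq_bigr => y my; rewrite -sum1dep_card.
  rewrite (reindex_onto (fun t : n.-tuple X => [tuple of y :: t])
    (fun t => [tuple of behead t])) /=; last first.
    by move=> t /andP[_ /eqP<-]; rewrite -tuple_eta.
  apply: eq_bigl => t; rewrite theadE eqxx andbT.
  have -> : [tuple of behead [tuple of y :: t]] = t by apply: val_inj.
  rewrite eqxx andbT; apply: eq_forallb => x; rewrite /= (eq_sym x).
  case: (eqVneq y x) => [<-|_]; first by rewrite -[in RHS](eqn_add2l 1) subnKC.
  by rewrite add0n subn0.
move=> t /forallP /(_ (thead t)) /eqP <-.
by rewrite [t]tuple_eta theadE /= eqxx.
Qed.

(** Induction on [n]: the words starting with [y] contribute [m y * n!], and the [m y] sum to
    [n.+1]. The product form avoids division in [nat]. *)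
Lemma card_tuple_count (n : nat) (m : X -> nat) : (\sum_x m x = n)%N ->
  (#|[set t : n.-tuple X | [forall x, count_mem x t == m x]]%SET| *
    \prod_x (m x)`! = n`!)%N.
Proof.
elim: n m => [|n IHn] m sum_m.
  have m0 x : m x = 0%N.
    by apply/eqP; rewrite -leqn0 -sum_m (bigD1 x) //= leq_addr.
  rewrite big1 => [|x _]; last by rewrite m0.
  rewrite muln1 (_ : [set _ | _]%SET = [set: 0.-tuple X]%SET).
    by rewrite cardsT card_tuple.
  by apply/setP => t; rewrite !inE tuple0; apply/forallP => x; rewrite m0.
rewrite card_tuple_count_cons big_distrl /= factS -[X in (X * n`!)%N]sum_m.
(* Letters with [m y = 0] add nothing on the right, so both sums range over the possible first
   letters. *)
rewrite [in RHS]big_distrl [RHS](bigID (fun y => 0 < m y)%N) /=.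
rewrite [X in _ = (_ + X)%N]big1 ?addn0; last first.
  by move=> y; rewrite lt0n negbK => /eqP ->.
apply: eq_bigr => y my.
rewrite -(IHn (fun x => m x - (x == y))%N); last first.
  apply: succn_inj; rewrite -sum_m (bigD1 y) //= [in RHS](bigD1 y) //= eqxx.
  rewrite -addSn subn1 prednK //; congr addn.
  by apply: eq_bigr => x /negPf ->; rewrite subn0.
rewrite mulnCA; congr muln.
(* Only the factor at [y] differs, and there [m y * (m y - 1)! = (m y)!]. *)
rewrite (bigD1 y) //= [in RHS](bigD1 y) //= eqxx subn1 mulnA.
rewrite -[in LHS](prednK my) factS prednK //; congr muln.
by apply: eq_bigr => x /negPf ->; rewrite subn0.
Qed.

End Multinomial.

(** * Fibres of the counting map: their size, and their description as orbits *)

Section CountingFibres.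
Context {R : realType} {X : finType} {N : nat}.
Implicit Types (z w : {ffun 'I_N -> X}) (p q : {perm 'I_N}).

Lemma countsE z x : counts z x = count_mem x [tuple z i | i < N].
Proof.
rewrite ffunE cardE size_filter count_map /= enumT.
by apply: eq_count => k; rewrite !inE.
Qed.

Lemma eq_counting_map z (m : count_vector X N) :
  (counting_map z == m) =
  [forall x, count_mem x [tuple z i | i < N] == m x].
Proof.
rewrite -val_eqE; apply/eqP/forallP => [<- x|H].
  by rewrite /= countsE.
by apply/ffunP => x; rewrite /= countsE; apply/eqP.
Qed.

Lemma card_counting_map (m : count_vector X N) :
  (\sum_(z : {ffun 'I_N -> X} | counting_map z == m) 1 = nu m :> R).
Proof.
have := @card_tuple_count X N m (eqP (count_vectorP m)).
rewrite -sum1dep_card.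
rewrite (reindex (fun z : {ffun 'I_N -> X} => [tuple z i | i < N])) /=; last first.
  exists (fun t : N.-tuple X => [ffun i => tnth t i]) => [z|t] _.
    by apply/ffunP => i; rewrite ffunE tnth_mktuple.
  by apply: eq_from_tnth => i; rewrite tnth_mktuple ffunE.
under eq_bigl do rewrite -eq_counting_map.
move/(congr1 (fun k : nat => k%:R : R)).
rewrite natrM natr_sum natr_prod /nu => <-; rewrite mulfK //.
by apply/prodf_neq0 => x _; rewrite pnatr_eq0 -lt0n fact_gt0.
Qed.

Lemma nu_neq0 (m : count_vector X N) : nu m != 0 :> R.
Proof.
rewrite mulf_neq0 ?invr_eq0 ?pnatr_eq0 -?lt0n ?fact_gt0 //.
by apply/prodf_neq0 => x _; rewrite pnatr_eq0 -lt0n fact_gt0.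
Qed.

Lemma perm_actM p q z : perm_act p (perm_act q z) = perm_act (p * q)%g z.
Proof. by apply/ffunP => k; rewrite !ffunE permM. Qed.

Lemma perm_act1 z : perm_act 1%g z = z.
Proof. by apply/ffunP => k; rewrite ffunE perm1. Qed.

Lemma perm_actK p : cancel (@perm_act X N p) (perm_act p^-1%g).
Proof. by move=> z; rewrite perm_actM mulVg perm_act1. Qed.

Lemma perm_actKV p : cancel (perm_act p^-1%g) (@perm_act X N p).
Proof. by move=> z; rewrite perm_actM mulgV perm_act1. Qed.

Lemma counting_map_perm p z : counting_map (perm_act p z) = counting_map z.
Proof.
apply: val_inj; apply/ffunP => x; rewrite !ffunE.
rewrite -[RHS](card_preimset _ (@perm_inj _ p)).
by apply: eq_card => k; rewrite !inE ffunE.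
Qed.

Lemma counting_map_transitive z w :
  counting_map z = counting_map w -> exists p, w = perm_act p z.
Proof.
move=> zw.
have /tuple_permP[p wp] : perm_eq [tuple w i | i < N] [tuple z i | i < N].
  (* [perm_eq] is by definition a test of equal multiplicities. *)
  by apply/allP => x _ /=; rewrite -!countsE (congr1 val zw : counts z = counts w).
exists p; apply/ffunP => k; rewrite ffunE.
have /(congr1 (fun t => tnth t k)) := val_inj wp.
by rewrite !tnth_mktuple.
Qed.

Lemma sum_counting_map_perm (F : {ffun 'I_N -> X} -> R) m p :
  \sum_(z | counting_map z == m) F (perm_act p z) =
  \sum_(z | counting_map z == m) F z.
Proof.
rewrite [RHS](reindex (perm_act p)) /=.
  by apply: eq_bigl => z; rewrite counting_map_perm.
by exists (perm_act p^-1%g) => z _; rewrite (perm_actK, perm_actKV).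
Qed.

(** Stabilisers need not be counted: the sum over permutations is constant on the fibre of [z], so
    it is computed by summing it over the whole fibre and exchanging the two sums. *)
Lemma sum_perm_act (F : {ffun 'I_N -> X} -> R) z :
  \sum_(p : {perm 'I_N}) F (perm_act p z) =
  (N`!)%:R * ((nu (counting_map z))^-1 *
    \sum_(w | counting_map w == counting_map z) F w).
Proof.
pose A w := \sum_(p : {perm 'I_N}) F (perm_act p w).
rewrite -/(A z) mulrCA; apply: (canRL (mulKf (nu_neq0 _))).
rewrite -card_counting_map big_distrl /=.
transitivity (\sum_(w | counting_map w == counting_map z) A w).
  apply: eq_bigr => w /eqP/esym/counting_map_transitive[q ->].
  (* Right translation by [q] permutes the group, so [A] agrees at [z] and at [perm_act q z]. *)
  rewrite mul1r /A (reindex_inj (mulIg q)).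
  by apply: eq_bigr => p _; rewrite perm_actM.
rewrite exchange_big /=; under eq_bigr do rewrite sum_counting_map_perm.
by rewrite sumr_const card_Sn mulr_natl.
Qed.

End CountingFibres.

(** * General facts on coherent lower previsions *)

Section Gambles.
Context {R : realType}.

Lemma gamble_eqP (Y : Type) (f g : gamble R Y) : (forall y, f y = g y) -> f = g.
Proof. by move=> fg; apply: val_inj; apply: funext. Qed.

Lemma gamble_sumE (Y : Type) (I : Type) (r : seq I) (F : I -> gamble R Y) y :
  (\sum_(i <- r) F i) y = \sum_(i <- r) F i y.
Proof. by elim/big_rec2: _ => // i a b _ <-. Qed.

Lemma coherent0 (Y : Type) (P : gamble R Y -> R) : coherent P -> P 0 = 0.
Proof. by case=> _ PZ _; rewrite -[in LHS](scale0r (0 : gamble R Y)) PZ ?mul0r. Qed.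

Lemma coherent_sum (Y : Type) (P : gamble R Y -> R) (I : Type) (r : seq I)
    (F : I -> gamble R Y) :
  coherent P -> \sum_(i <- r) P (F i) <= P (\sum_(i <- r) F i).
Proof.
move=> hP; elim/big_rec2: _ => [|i a b _ ab]; first by rewrite coherent0.
by case: hP => _ _ /(_ (F i) a); apply: le_trans; rewrite lerD2l.
Qed.

Lemma coherent_comp {Y Z : Type} (y0 : Y) (t : Y -> Z) (P : gamble R Y -> R) :
  coherent P -> coherent (fun h : gamble R Z => P (gamble_comp h t)).
Proof.
move=> [Pinf PZ PD]; split => [h|h a a0|h h'].
(* Composition with [t] shrinks the range and so raises the infimum. The point [y0] rules out an
   empty range, whose [inf] would be the default value 0. *)
- apply: le_trans (Pinf _); apply: lb_le_inf; first by exists (h (t y0)), y0.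
  have /bounded_predP[M hM] := gambleP h.
  move=> _ [y _ <-]; apply: ge_inf; last by exists (t y).
  by exists (- M) => _ [z _ <-]; have := hM z; rewrite ler_norml => /andP[].
- by rewrite -PZ //; congr P; apply: gamble_eqP.
- by apply: le_trans (PD _ _) _; rewrite le_eqVlt; apply/orP; left; apply/eqP;
    congr P; apply: gamble_eqP.
Qed.

End Gambles.

(** * Representation of exchangeable lower previsions *)

Section Representation.
Context {R : realType} {X : finType} {N : nat}.
Implicit Types (f : gamble R {ffun 'I_N -> X}) (h : gamble R (count_vector X N)).

Lemma MuHy_comp h : MuHy (gamble_comp h counting_map) = h.
Proof.
apply: gamble_eqP => m; rewrite /= /MuHy_fun /=.
rewrite (eq_bigr (fun=> 1 * h m)) => [|z /eqP ->]; last by rewrite mul1r.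
by rewrite -big_distrl /= card_counting_map mulKf ?nu_neq0.
Qed.

Lemma MuHy_perm f p : MuHy (perm_gamble p f - f) = 0.
Proof.
apply: gamble_eqP => m; rewrite /= /MuHy_fun /= sumrB.
by rewrite sum_counting_map_perm subrr mulr0.
Qed.

Lemma sum_perm_gamble f :
  \sum_(p : {perm 'I_N}) perm_gamble p f =
  (N`!)%:R *: gamble_comp (MuHy f) counting_map.
Proof. by apply: gamble_eqP => z; rewrite gamble_sumE /= sum_perm_act. Qed.

Lemma exchangeable_MuHy P f : coherent P -> exchangeable P ->
  P f = P (gamble_comp (MuHy f) counting_map).
Proof.
move=> hP eP; have [_ PZ PD] := hP.
set S := \sum_(p : {perm 'I_N}) perm_gamble p f.
have N0 : 0 <= (N`!)%:R :> R by rewrite ler0n.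
have Nf : \sum_(p : {perm 'I_N}) f = (N`!)%:R *: f.
  by rewrite sumr_const card_Sn scaler_nat.
have ge0 : 0 <= P (S - (N`!)%:R *: f).
  rewrite -Nf -sumrB; apply: le_trans (coherent_sum _ _ _ _ _ hP) => //.
  by apply: sumr_ge0 => p _; apply: eP.
have le0 : 0 <= P ((N`!)%:R *: f - S).
  rewrite -Nf -sumrB; apply: le_trans (coherent_sum _ _ _ _ _ hP) => //.
  (* Exchangeability applied to [perm_gamble p f] and the inverse of [p] gives the opposite sign. *)
  apply: sumr_ge0 => p _; rewrite (_ : f - _ =
    perm_gamble p^-1%g (perm_gamble p f) - perm_gamble p f); first exact: eP.
  by congr (_ - _); apply: gamble_eqP => z /=; rewrite perm_actKV.
have N_neq0 : (N`!)%:R != 0 :> R by rewrite pnatr_eq0 -lt0n fact_gt0.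
(* By homogeneity it suffices to compare [P] at [N! *: f] and at [S]; superadditivity turns [ge0]
   and [le0] into the two inequalities. *)
apply: (mulfI N_neq0).
rewrite -!PZ // -sum_perm_gamble -/S.
apply/le_anti/andP; split.
  have := PD (S - (N`!)%:R *: f) ((N`!)%:R *: f).
  by rewrite subrK; apply: le_trans; rewrite lerDr.
have := PD ((N`!)%:R *: f - S) S.
by rewrite subrK; apply: le_trans; rewrite lerDr.
Qed.

End Representation.

Theorem theorem2 (R : realType) (X : finType) (N : nat)
    (hX : (0 < #|X|)%N) (hN : (0 < N)%N)
    (P : gamble R {ffun 'I_N -> X} -> R) (hP : coherent P) :
  (exchangeable P <->
   exists Q : gamble R (count_vector X N) -> R,
     coherent Q /\
     forall f : gamble R {ffun 'I_N -> X}, P f = Q (MuHy f)) /\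
  (exchangeable P ->
   forall Q : gamble R (count_vector X N) -> R,
     (coherent Q /\
      forall f : gamble R {ffun 'I_N -> X}, P f = Q (MuHy f)) <->
     (forall h : gamble R (count_vector X N),
        Q h = P (gamble_comp h counting_map))).
Proof.
(* The constant word at [x0] is the point that [coherent_comp] requires. *)
have /card_gt0P[x0 _] := hX.
have PT := coherent_comp [ffun=> x0] (@counting_map X N) P hP.
split; first split.
- move=> eP; exists (fun h => P (gamble_comp h counting_map)); split=> // f.
  exact: exchangeable_MuHy.
- by move=> [Q [cQ PQ]] f p; rewrite PQ MuHy_perm coherent0.
(* Uniqueness: evaluate the representation at [gamble_comp h counting_map], which [MuHy] sends back
   to [h]. *)
move=> eP Q; split=> [[_ PQ] h|QP]; first by rewrite PQ MuHy_comp.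
rewrite (_ : Q = fun h => P (gamble_comp h counting_map)); last exact: funext.
by split=> // f; exact: exchangeable_MuHy.
Qed.
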